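(* Let $d\ge 2$ and $k\ge 2$ be fixed integers and let $F^2_k$ be the binary caterpillar with $k$ leaves. Then $$\max_{|T|=n,\ T\text{ strictly }d\text{-ary}}\frac{c(F^2_k,T)}{\binom{n}{k}}=1-\mathcal{O}(n^{-1}),$$ i.e. there is a constant $K=K(d,k)$ such that for all integers $n\ge k$ with $n\equiv 1\bmod (d-1)$ the left-hand side differs from $1$ by at most $K/n$. In particular, $i_d(F^2_k)=I_d(F^2_k)=1$.
   Context: All trees are finite and rooted, with unordered children; isomorphism means isomorphism of rooted trees. The single vertex is regarded as a tree whose only vertex is both root and leaf. For a rooted tree $T$, $|T|$ denotes its number of leaves. For an integer $d\ge 2$, a $d$-ary tree is a rooted tree in which every non-leaf vertex has between $2$ and $d$ children; it is strictly $d$-ary if every non-leaf vertex has exactly $d$ children. (An $n$-leaf strictly $d$-ary tree exists iff $n\ge 1$ and $n\equiv 1 \bmod (d-1)$.) A binary tree is a $2$-ary tree. For a nonempty set $S$ of leaves of $T$, the subtree of $T$ induced by $S$ is obtained by taking the minimal subtree of $T$ containing the leaves in $S$, rooting it at the most recent common ancestor of $S$, and suppressing (contracting) all non-root vertices of degree $2$. Let $c(D,T)$ be the number of sets of $|D|$ leaves of $T$ whose induced subtree is isomorphic to $D$, and for $|T|\ge |D|$ let $\gamma(D,T)=c(D,T)/\binom{|T|}{|D|}$. For a $d$-ary tree $D$ define $$I_d(D)=\limsup_{n\to\infty}\ \max_{|T|=n,\ T\ d\text{-ary}}\gamma(D,T),\qquad i_d(D)=\limsup_{n\to\infty}\ \max_{|T|=n,\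 T\text{ strictly }d\text{-ary}}\gamma(D,T),$$ where in the second definition $n$ ranges over integers $n\equiv 1 \bmod (d-1)$. The binary caterpillar $F^2_k$ ($k\ge 2$) is the binary tree with $k$ leaves in which the non-leaf vertices form a path starting at the root, every non-leaf vertex except the lowest has exactly one leaf child (and one non-leaf child), and the lowest non-leaf vertex has two leaf children. *)

(* Defs.v *)
From HB Require Import structures.
From mathcomp Require Import all_boot all_order all_algebra.
From mathcomp Require Import all_classical all_reals all_analysis.

Set Implicit Arguments.
Unset Strict Implicit.
Unset Printing Implicit Defensive.

Import Order.TTheory GRing.Theory Num.Theory.

Local Open Scope classical_set_scope.
Local Open Scope ring_scope.

(* The list of children carries an order, but trees are only ever compared
   through [iso], which ignores it. *)
Inductive tree : Type := Node of seq tree.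

Definition leaf : tree := Node [::].

Inductive iso : tree -> tree -> Prop :=
| IsoNode (s t : seq tree) (f : 'I_(size s) -> 'I_(size t)) of
    bijective f &
    (forall i, iso (tnth (in_tuple s) i) (tnth (in_tuple t) (f i))) :
    iso (Node s) (Node t).

(* A vertex is addressed by the path of child indices leading to it from the
   root; [leaves T] lists the addresses of the leaves of T. *)
Fixpoint leaves (T : tree) : seq (seq nat) :=
  let: Node ts := T in
  if nilp ts then [:: [::]] else
  flatten [seq [seq p.1 :: a | a <- p.2]
          | p <- zip (iota 0 (size ts)) [seq leaves t | t <- ts]].

Definition nleaves (T : tree) : nat := size (leaves T).

Definition leaf_of (T : tree) : finType := seq_sub (leaves T).

Fixpoint all_inner (p : pred nat) (T : tree) : bool :=
  let: Node ts := T in nilp ts || p (size ts) && all (all_inner p) ts.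

Definition dary (d : nat) : pred tree := all_inner (fun m => 2 <= m <= d)%N.

Definition strictly_dary (d : nat) : pred tree := all_inner (fun m => m == d).

(* Deletes every non-root vertex with no descendant leaf in S: what remains is
   the minimal subtree containing S together with the root of T. *)
Fixpoint prune (T : tree) (S : pred (seq nat)) : tree :=
  let: Node ts := T in
  Node [seq p.2.2 (fun a => S (p.1 :: a))
       | p <- zip (iota 0 (size ts)) [seq (leaves t, prune t) | t <- ts]
       & has (fun a => S (p.1 :: a)) p.2.1].

(* The most recent common ancestor of all leaves of T is the first vertex, on
   the way down from the root, whose number of children is not 1. *)
Fixpoint at_mrca (T : tree) : tree :=
  match T with
  | Node [:: t] => at_mrca t
  | _ => T
  end.

(* Suppresses all vertices with exactly one child, T's root included. *)
Fixpoint suppress (T : tree) : tree :=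
  match T with
  | Node [:: t] => suppress t
  | Node ts => Node [seq suppress t | t <- ts]
  end.

(* A non-root vertex has degree 2 iff it has exactly one child, so the root is
   exempt from suppression. *)
Definition induced (T : tree) (S : {set leaf_of T}) : tree :=
  let: Node ts := at_mrca (prune T (mem [seq val x | x in S])) in
  Node [seq suppress t | t <- ts].

Definition c (D T : tree) : nat :=
  #|[pred S : {set leaf_of T} |
      (#|S| == nleaves D) && `[< iso (induced S) D >]]|.

(* k.-1 inner vertices, hence k leaves for k >= 1. *)
Definition caterpillar2 (k : nat) : tree :=
  iter k.-1 (fun t => Node [:: leaf; t]) leaf.

Section Density.
Variable R : realType.

Definition gamma (D T : tree) : R :=
  (c D T)%:R / 'C(nleaves T, nleaves D)%:R.

(* The greatest element of A, and 0 by convention if A has none. *)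
Definition maximum (A : set R) : R := xget 0 (A `&` ubound A).

Definition max_tree (P : pred tree) (n : nat) (f : tree -> R) : R :=
  maximum [set f T | T in [set T | P T /\ nleaves T = n]].

Definition inducibility (d : nat) (D : tree) : \bar R :=
  limf_esup (fun n => (max_tree (dary d) n (gamma D))%:E) \oo.

Definition strict_inducibility (d : nat) (D : tree) : \bar R :=
  limf_esup (fun n => (max_tree (strictly_dary d) n (gamma D))%:E)
    (within [set n : nat | n = 1 %[mod d.-1]] \oo).

End Density.

(* Main.v *)
Require Import Defs.
From mathcomp Require Import all_boot all_order all_algebra.
From mathcomp Require Import all_classical all_reals all_analysis.

(** Hang d - 1 leaves (d at the bottom) on every vertex of a path.  A set of k
leaves at pairwise distinct depths of this tree induces the binary caterpillar.
A leaf shares its depth with fewer than d others, so the other k-sets are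
covered by at most n d families of 'C(n - 2, k - 2) sets each, one for each
ordered pair of distinct leaves at equal depth; these families make up a
proportion O(1/n) of all k-sets.  For I_d, where n is arbitrary, the same tree
with d = 2 serves. *)

Import Order.TTheory GRing.Theory Num.Theory.

Set Implicit Arguments.
Unset Strict Implicit.
Unset Printing Implicit Defensive.

Local Open Scope nat_scope.

(** * Isomorphism is reflexive; combs, their leaf addresses and depths *)

Lemma iso_refl : forall T, iso T T.
Proof.
fix IH 1 => -[s].
apply: (@IsoNode s s id); first by exists id.
move=> i; rewrite (tnth_nth leaf) /=.
(* Induction on the list exposes each child as a subterm, as the guard condition on [IH]
   requires. *)
elim: s i => [|t s IHs] i; first by case: (notF (ltn_ord i)).
case: i => -[|i] ltis /=; first exact: IH.
exact: (IHs (Ordinal (ltis : (i < size s)%N))).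
Qed.

(** The spine child comes last, so its index is always [e]. Inner vertices have [e.+1] children:
    [e = d.-1] is the strictly d-ary case, [e = 1] the binary caterpillar. *)
Definition comb (e m : nat) : tree :=
  iter m (fun t => Node (rcons (nseq e leaf) t)) leaf.

Lemma combS e m : comb e m.+1 = Node (rcons (nseq e leaf) (comb e m)).
Proof. by []. Qed.

Lemma zip_iota_nseq (U : Type) e (x : U) m :
  zip (iota m e) (nseq e x) = [seq (i, x) | i <- iota m e].
Proof. by elim: e m => //= e IHe m; rewrite IHe. Qed.

Lemma zip_iota_rcons (U : Type) e (x y : U) :
  zip (iota 0 e.+1) (rcons (nseq e x) y) =
  [seq (i, x) | i <- iota 0 e] ++ [:: (e, y)].
Proof.
rewrite -addn1 iotaD -cats1 zip_cat ?size_iota ?size_nseq //.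
by rewrite zip_iota_nseq.
Qed.

Lemma leaves_comb e m :
  leaves (comb e m.+1) =
  [seq [:: i] | i <- iota 0 e] ++ [seq e :: a | a <- leaves (comb e m)].
Proof.
rewrite combS /= size_rcons size_nseq /nilp size_rcons.
rewrite map_rcons map_nseq /= zip_iota_rcons map_cat flatten_cat /= cats0.
congr (_ ++ _); rewrite -map_comp.
by elim: (iota 0 e) => //= i s ->.
Qed.

Lemma leaves_comb_uniq e m : uniq (leaves (comb e m)).
Proof.
elim: m => [//|m IHm]; rewrite leaves_comb cat_uniq.
rewrite !map_inj_uniq ?iota_uniq ?IHm; try by move=> ? ? [].
rewrite andbT; apply/hasPn => _ /mapP[a _ ->].
apply/mapP => -[i]; rewrite mem_iota add0n => /= lt_ie [eq_ei].
by rewrite eq_ei ltnn in lt_ie.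
Qed.

Lemma nleaves_comb e m : nleaves (comb e m) = m * e + 1.
Proof.
elim: m => [//|m IHm]; rewrite /nleaves leaves_comb size_cat !size_map size_iota.
by rewrite -/(nleaves _) IHm mulSn addnA.
Qed.

Lemma all_inner_comb (p : pred nat) e m : p e.+1 -> all_inner p (comb e m).
Proof.
move=> pe; elim: m => [//|m IHm]; rewrite combS /=.
by rewrite size_rcons size_nseq pe all_rcons IHm all_nseq /= !orbT.
Qed.

(** Depth 1 holds the [e] leaves hung on the root and, when the spine stops there, its end as well;
    deeper leaves belong to the remaining comb, one level up. Only the bottom level reaches
    [e.+1]. *)
Lemma count_depth_comb e m j :
  count (fun a => size a == j) (leaves (comb e m)) <= e.+1.
Proof.
have root_leaf m' :
  count (fun a : seq nat => size a == 0) (leaves (comb e m')) <= 1.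
  case: m' => [//|m']; rewrite leaves_comb count_cat !count_map.
  by rewrite !(@eq_count _ _ pred0) // !count_pred0.
elim: m j => [|m IHm] [|j]; rewrite ?(leq_trans (root_leaf _)) //.
rewrite leaves_comb count_cat !count_map /=.
case: j => [|j].
  rewrite -[e.+1]addn1 leq_add ?root_leaf //.
  by rewrite (leq_trans (count_size _ _)) // size_iota.
by rewrite (@eq_count _ _ pred0) // count_pred0 add0n IHm.
Qed.

(** * Subtrees induced in a comb *)

Lemma prune_comb e m (S : pred (seq nat)) :
  prune (comb e m.+1) S =
  Node (nseq (count (fun i => S [:: i]) (iota 0 e)) leaf ++
        (if has (fun a => S (e :: a)) (leaves (comb e m))
         then [:: prune (comb e m) (fun a => S (e :: a))] else [::])).
Proof.
rewrite combS /= size_rcons size_nseq map_rcons map_nseq /= zip_iota_rcons.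
rewrite filter_cat map_cat /=; congr (Node (_ ++ _)); last by case: ifP.
rewrite filter_map -map_comp /= -size_filter.
rewrite (@eq_filter _ _ (fun i => S [:: i])); last by move=> i /=; rewrite orbF.
by elim: [seq i <- _ | _] => //= i s ->.
Qed.

Lemma caterpillar2S k : caterpillar2 k.+2 = Node [:: leaf; caterpillar2 k.+1].
Proof. by []. Qed.

Lemma nleaves_caterpillar2 k : 0 < k -> nleaves (caterpillar2 k) = k.
Proof.
case: k => [//|k] _; elim: k => [//|k IHk].
by rewrite -[RHS]/(k.+1.+1) -[in RHS]IHk caterpillar2S /nleaves /= cats0 size_map.
Qed.

(** At most one selected leaf hangs on the top vertex. If there is one and the rest is also met, the
    top vertex adds a caterpillar level; otherwise it keeps a single child and is suppressed. *)
Lemma suppress_prune_comb e m (S : pred (seq nat)) :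
  {in leaves (comb e m) &, forall a b, S a -> S b -> size a = size b -> a = b} ->
  has S (leaves (comb e m)) ->
  suppress (prune (comb e m) S) = caterpillar2 (count S (leaves (comb e m))).
Proof.
elim: m S => [|m IHm] S; first by move=> _ /= /orP[->|].
rewrite prune_comb leaves_comb has_cat count_cat !count_map !has_map => injS.
set c1 := count _ _; set S' := fun a => S (e :: a).
(* Two selected leaves hung on the top vertex would both have depth 1. *)
have c1_le1 : c1 <= 1.
  rewrite /c1 -size_filter; set s := [seq i <- _ | _].
  have : uniq s by rewrite filter_uniq ?iota_uniq.
  have : {in s, forall i, [:: i] \in leaves (comb e m.+1) /\ S [:: i]}.
    move=> i; rewrite mem_filter => /andP[Si i_iota]; split=> //.
    by rewrite leaves_comb mem_cat map_f.
  case: s => [//|i [//|j s]] inj_s /= /andP[]; rewrite inE negb_or => /andP[] /eqP[].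
  have [|ileaf Si] := inj_s i; first by rewrite inE eqxx.
  have [|jleaf Sj] := inj_s j; first by rewrite !inE eqxx orbT.
  by rewrite leaves_comb in ileaf jleaf; have [] := injS _ _ ileaf jleaf Si Sj erefl.
rewrite (@eq_has _ (preim _ S) S') // (@eq_count _ (preim (cons e) S) S') //.
rewrite has_count -/c1.
have S'E : has S' (leaves (comb e m)) ->
  suppress (prune (comb e m) S') = caterpillar2 (count S' (leaves (comb e m))).
  apply: IHm => a b aleaf bleaf Sa Sb eq_ab.
  suff [] : e :: a = e :: b by [].
  by apply: injS; rewrite ?mem_cat ?map_f ?orbT //= eq_ab.
case: ifPn => [hasS' _ | nohasS'].
  case: c1 c1_le1 => [|[|//]] _ /=; rewrite S'E //.
  (* [caterpillar2] sends 0 and 1 both to the leaf, so adding a level requires a positive remaining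
     count. *)
  rewrite -[1 + _]/(_.+1).
  by case: count (has_count S' (leaves (comb e m))) => //; rewrite hasS'.
rewrite orbF => c1_gt0; have c11 : c1 = 1 by apply/eqP; rewrite eqn_leq c1_le1.
have noS' : count S' (leaves (comb e m)) = 0.
  by apply/eqP; rewrite -leqn0 leqNgt -has_count.
by rewrite noS' c11.
Qed.

(** [suppress] descends through unary vertices exactly to the most recent common ancestor, which is
    not unary; exempting that vertex thus changes nothing. *)
Lemma inducedE T (S : {set leaf_of T}) :
  Defs.induced S = suppress (prune T (mem [seq val x | x in S])).
Proof.
rewrite /Defs.induced.
suff suppress_mrca : forall T', suppress T' =
    let: Node ts := at_mrca T' in Node [seq suppress t | t <- ts].
  by rewrite -suppress_mrca.
by fix IH 1 => -[[|t [|t' ts]]] //=; apply: IH.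
Qed.

(** * Counting sets that contain a collision *)

Lemma card_draws_containing2 (L : finType) (a b : L) k : a != b -> 2 <= k ->
  #|[set S : {set L} | (#|S| == k) && (a \in S) && (b \in S)]| <= 'C(#|L|.-2, k.-2).
Proof.
move=> neq_ab k_ge2; set D := [set a; b].
have cardD : #|D| = 2 by rewrite cards2 neq_ab.
have cardDC : #|~: D| = #|L|.-2 by rewrite cardsCs finset.setCK cardD subn2.
(* Removing [a] and [b] is injective on these sets and lands in the [k.-2]-subsets of the complement
   of [D]. *)
rewrite -cardDC -cards_draws -(@card_in_imset _ _ (fun S => S :\: D)).
  apply/subset_leq_card/fintype.subsetP => _ /imsetP[S + ->].
  rewrite !inE -andbA => /and3P[/eqP cardS aS bS].
  have DS : D \subset S.
    by rewrite finset.subUset !finset.sub1set aS bS.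
  rewrite finset.setDE finset.subsetIr -finset.setDE cardsD.
  by rewrite (finset.setIidPr DS) cardS cardD subn2 eqxx.
move=> S1 S2; rewrite !inE -!andbA => /and3P[_ a1 b1] /and3P[_ a2 b2] eqS.
have DS (S : {set L}) : a \in S -> b \in S -> S = D :|: (S :\: D).
  move=> aS bS.
  have /finset.setIidPr DS : D \subset S.
    by rewrite finset.subUset !finset.sub1set aS bS.
  by rewrite -{1}(finset.setID S D) DS.
by rewrite (DS S1) // (DS S2) // eqS.
Qed.

(** Union bound over the at most [#|L| * d] colliding ordered pairs. The factor [#|L|.-1] clears the
    denominator in the ratio of ['C(#|L|.-2, k.-2)] to ['C(#|L|, k)]. *)
Lemma card_collision_sets (L : finType) (f : L -> nat) d k : 2 <= k ->
  (forall j, #|[set b | f b == j]| <= d) ->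
  #|L|.-1 * #|[set S : {set L} | (#|S| == k) &&
       [exists a in S, exists b in S, (a != b) && (f a == f b)]]|
    <= d * (k * k.-1) * 'C(#|L|, k).
Proof.
move=> k_ge2 fib; set bad := [set S | _].
set P := [set p : L * L | (p.1 != p.2) && (f p.1 == f p.2)].
pose B (p : L * L) := [set S : {set L} | (#|S| == k) && (p.1 \in S) && (p.2 \in S)].
have cardP : #|P| <= #|L| * d.
  rewrite -sum1_card (eq_bigl (fun p => true && ((p.1 != p.2) && (f p.1 == f p.2)))).
    rewrite -(pair_big_dep xpredT
      (fun a b => (a != b) && (f a == f b)) (fun _ _ => 1)) /=.
    rewrite -sum_nat_const; apply: leq_sum => a _.
    rewrite sum1_card; apply: leq_trans (fib (f a)).
    apply/subset_leq_card/fintype.subsetP => b.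
    by rewrite !inE => /andP[_ /eqP->].
  by move=> p; rewrite inE.
have bad_le : #|bad| <= #|P| * 'C(#|L|.-2, k.-2).
  apply: (@leq_trans (\sum_(p in P) #|B p|)).
    apply: leq_trans (_ : #|\bigcup_(p in P) B p| <= _).
      apply/subset_leq_card/fintype.subsetP => S; rewrite !inE.
      case/andP=> cardS /exists_inP[a aS /exists_inP[b bS abP]].
      by apply/bigcupP; exists (a, b); rewrite inE //= cardS aS bS.
    apply: (big_ind2 (fun (X : {set {set L}}) n => #|X| <= n));
      rewrite ?cards0 //.
    move=> X1 n1 X2 n2 le1 le2; apply: leq_trans (leq_add le1 le2).
    by rewrite leq_card_setU.
  rewrite -sum_nat_const; apply: leq_sum => p; rewrite inE => /andP[neq _].
  exact: card_draws_containing2.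
have binE : #|L| * #|L|.-1 * 'C(#|L|.-2, k.-2) = k * k.-1 * 'C(#|L|, k).
  case: k k_ge2 {bad B bad_le} => [|[|k]] // _ /=.
  by rewrite -mulnA mul_bin_diag mulnCA mul_bin_diag mulnA [_.+1 * _.+2]mulnC.
rewrite -mulnA -binE.
apply: leq_trans (leq_mul (leqnn _) (leq_trans bad_le (leq_mul cardP (leqnn _)))) _.
by rewrite -!mulnA mulnCA [leqRHS]mulnCA leq_mul // mulnCA.
Qed.

(** * Bounds on the number of induced copies *)

Lemma card_leaf_of_le T : #|leaf_of T| <= nleaves T.
Proof.
rewrite cardE -(size_map val) uniq_leq_size //.
  by rewrite map_inj_uniq ?enum_uniq //; apply: val_inj.
by move=> _ /mapP[x _ ->]; apply: valP.
Qed.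

Lemma c_le_bin D T : c D T <= 'C(nleaves T, nleaves D).
Proof.
apply: leq_trans (leq_bin2l _ (card_leaf_of_le T)).
rewrite -card_draws; apply/subset_leq_card/fintype.subsetP => S.
by rewrite !inE => /andP[].
Qed.

Lemma count_leaf_set T (S : {set leaf_of T}) : uniq (leaves T) ->
  count (mem [seq val x | x in S]) (leaves T) = #|S|.
Proof.
move=> uT; rewrite -size_filter -(size_image val S).
apply/perm_size/uniq_perm; rewrite ?filter_uniq //.
  by rewrite map_inj_uniq ?enum_uniq //; apply: val_inj.
move=> a; rewrite mem_filter andb_idr //.
by case/mapP => x _ ->; apply: valP.
Qed.

(** The k-sets are covered by those inducing the caterpillar and those with two leaves at equal
    depth; the collision bound is applied to depth. *)
Lemma c_caterpillar2_comb e m k : 2 <= k ->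
  'C(nleaves (comb e m), k) * (nleaves (comb e m)).-1 <=
  c (caterpillar2 k) (comb e m) * (nleaves (comb e m)).-1 +
  e.+1 * (k * k.-1) * 'C(nleaves (comb e m), k).
Proof.
move=> k_ge2; have uT := leaves_comb_uniq e m.
set T := comb e m in uT *.
have cardL : #|leaf_of T| = nleaves T by exact: card_seq_sub.
have k_gt0 : 0 < k by exact: ltnW.
pose depth (x : leaf_of T) := size (val x).
have fib j : #|[set x | depth x == j]| <= e.+1.
  apply: leq_trans (count_depth_comb e m j); rewrite cardE -(size_map val) -size_filter.
  apply: uniq_leq_size; first by rewrite map_inj_uniq ?enum_uniq //; apply: val_inj.
  move=> _ /mapP[x + ->]; rewrite mem_enum inE mem_filter => ->.
  exact: valP.
have := card_collision_sets k_ge2 fib; rewrite cardL.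
set bad := [set S | _] => bad_le.
rewrite -{1}cardL -card_draws.
apply: leq_trans (leq_add (leqnn _) bad_le).
rewrite [X in _ + X]mulnC -mulnDl leq_mul2r; apply/orP; right.
rewrite /c -[X in X + _]cardsE.
apply: leq_trans (leq_card_setU _ _).
apply/subset_leq_card/fintype.subsetP => S; rewrite !inE => /eqP cardS.
rewrite nleaves_caterpillar2 // cardS eqxx /= orbC -implyNb; apply/implyP => nobad.
apply/asboolP; rewrite inducedE suppress_prune_comb.
- by rewrite count_leaf_set // cardS; apply: iso_refl.
- move=> _ _ _ _ /mapP[x + ->] /mapP[y + ->]; rewrite !mem_enum => xS yS eq_xy.
  congr val; apply/eqP; apply: contraNT nobad => neq_xy.
  apply/exists_inP; exists x => //; apply/exists_inP; exists y => //.
  by rewrite neq_xy /depth eq_xy /=.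
- by rewrite has_count count_leaf_set // cardS.
Qed.

Local Open Scope ring_scope.

(** * Maximal densities over trees with [n] leaves *)

Lemma max_tree_le (R : realType) (P : pred tree) n (f : tree -> R) (b : R) : 0 <= b ->
  (forall T, P T -> nleaves T = n -> f T <= b) -> max_tree P n f <= b.
Proof.
(* [0 <= b] handles the default value 0 of [maximum]. *)
move=> b_ge0 fb; rewrite /max_tree /maximum; case: xgetP => [x _ [[T [PT nT] <-] _]|//].
exact: fb.
Qed.

(** The numerators are bounded naturals over a fixed denominator, so a greatest value is attained
    and [maximum] does not fall back to its default. *)
Lemma max_tree_ge (R : realType) (P : pred tree) n (g : tree -> nat) (q : R) M T :
  0 <= q ->
  (forall T', P T' -> nleaves T' = n -> (g T' <= M)%N) ->
  P T -> nleaves T = n -> (g T)%:R / q <= max_tree P n (fun T' => (g T')%:R / q).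
Proof.
move=> q_ge0 gM PT nT.
pose attained j := `[< exists T', [/\ P T', nleaves T' = n & g T' = j] >].
have attainedT : exists j, attained j by exists (g T); apply/asboolP; exists T.
have attained_le j : attained j -> (j <= M)%N.
  by move=> /asboolP[T' [PT' nT' <-]]; apply: gM.
have [_ /asboolP[T0 [PT0 nT0 <-]] g_max] := ex_maxnP attainedT attained_le.
rewrite /max_tree /maximum; case: xgetP => [x _ [_ ub]|/(_ ((g T0)%:R / q))[]].
  by apply: ub; exists T.
split; first by exists T0.
move=> _ [T' [PT' nT'] <-]; rewrite ler_wpM2r ?invr_ge0 // ler_nat.
by apply: g_max; apply/asboolP; exists T'.
Qed.

Lemma eq_max_tree (R : realType) (P : pred tree) n (f g : tree -> R) :
  (forall T, nleaves T = n -> f T = g T) -> max_tree P n f = max_tree P n g.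
Proof.
by move=> fg; rewrite /max_tree; congr maximum; apply: eq_imagel => T [_ /fg].
Qed.

Lemma density_le1 (R : realType) D T :
  (c D T)%:R / 'C(nleaves T, nleaves D)%:R <= 1 :> R.
Proof.
have [->|bin_gt0] := posnP 'C(nleaves T, nleaves D); first by rewrite invr0 mulr0 ler01.
by rewrite ler_pdivrMr ?ltr0n // mul1r ler_nat c_le_bin.
Qed.

Lemma density_comb_ge (R : realType) e m k :
  (2 <= k)%N -> (k <= nleaves (comb e m))%N ->
  1 - (2 * (e.+1 * (k * k.-1)))%:R / (nleaves (comb e m))%:R <=
  (c (caterpillar2 k) (comb e m))%:R / 'C(nleaves (comb e m), k)%:R :> R.
Proof.
move=> k_ge2; have := c_caterpillar2_comb e m k_ge2.
move: (c _ _) (nleaves _) (e.+1 * _)%N => x n K0 le_bin k_le_n.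
have bin_gt0 : 0 < 'C(n, k)%:R :> R by rewrite ltr0n bin_gt0.
case: n k_le_n le_bin bin_gt0 => [|n].
  by rewrite leqn0 => /eqP k0; rewrite k0 in k_ge2.
move=> k_le_n; rewrite succnK => le_bin bin_gt0.
have n_gt0 : (0 < n)%N by rewrite -ltnS (leq_trans k_ge2).
have n_gt0R : 0 < n%:R :> R by rewrite ltr0n.
(* The tree has [n.+1] leaves here; the constant 2 comes from [1 / n <= 2 / n.+1]. *)
apply: (@le_trans _ _ (1 - K0%:R / n%:R)).
  rewrite lerD2l lerN2 ler_pdivrMr // mulrAC ler_pdivlMr ?ltr0n //.
  rewrite -!natrM ler_nat [(2 * _)%N]mulnC -mulnA leq_mul //.
  by rewrite mul2n -addnn -addn1 leq_add2l.
rewrite lerBlDr -(ler_pM2r bin_gt0) mul1r mulrDl divfK ?gt_eqF //.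
rewrite -(ler_pM2r n_gt0R) mulrDl [_ / _ * _]mulrAC -[_ * _^-1 * _]mulrA.
rewrite mulVf ?gt_eqF // mulr1.
by rewrite -!natrM -natrD ler_nat.
Qed.

(** * Limits superior and the theorem *)

Lemma limf_esup_eq1 (R : realType) (F : set_system nat) (f : nat -> R) (K : R) :
  F setT -> (forall n, f n <= 1) ->
  (forall A, F A -> forall N, exists n, [/\ A n, (N <= n)%N & 1 - K / n%:R <= f n]) ->
  limf_esup (fun n => (f n)%:E) F = 1%E.
Proof.
move=> FT f_le1 f_ge; apply/eqP; rewrite eq_le; apply/andP; split.
  apply: le_trans (ereal_inf_lbound _) _; first by exists setT.
  by apply: ge_ereal_sup => _ [n _ <-]; rewrite lee_fin.
apply: le_ereal_inf_tmp => _ [A FA <-]; apply/lee_addgt0Pr => eps eps_gt0.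
(* Taking [n] above [|K| / eps] makes [K / n] at most [eps]. *)
have [n [An le_n f_gen]] := f_ge A FA (Num.trunc (`|K| / eps)).+1.
rewrite -leeBlDr //.
apply: le_ereal_sup_tmp; exists (f n)%:E; first by exists n.
rewrite -EFinB lee_fin (le_trans _ f_gen) // lerD2l lerN2.
have n_gt : `|K| / eps < n%:R by rewrite (lt_le_trans (truncnS_gt _)) // ler_nat.
have n_gt0 : 0 < n%:R :> R by rewrite (le_lt_trans _ n_gt) // divr_ge0 // ltW.
rewrite ler_pdivrMr // (le_trans (ler_norm K)) // mulrC -ler_pdivrMr //.
exact: ltW.
Qed.

Theorem theorem2 (R : realType) (d k : nat) (hd : (2 <= d)%N) (hk : (2 <= k)%N) :
  (exists K : R, forall n : nat, (k <= n)%N -> n = 1 %[mod d.-1] ->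
     `| max_tree (strictly_dary d) n
          (fun T => (c (caterpillar2 k) T)%:R / 'C(n, k)%:R : R) - 1 |
       <= K / n%:R) /\
  strict_inducibility R d (caterpillar2 k) = 1%E /\
  inducibility R d (caterpillar2 k) = 1%E.
Proof.
have k_gt0 : (0 < k)%N by exact: ltnW.
pose density n T : R := (c (caterpillar2 k) T)%:R / 'C(n, k)%:R.
pose K e : R := (2 * (e.+1 * (k * k.-1)))%:R.
have densityE n T : nleaves T = n -> gamma R (caterpillar2 k) T = density n T.
  by move=> nT; rewrite /gamma nT nleaves_caterpillar2.
have density_le n T : nleaves T = n -> density n T <= 1.
  by move=> nT; rewrite -(densityE n T nT) density_le1.
(* Used with [e = d.-1] for strictly d-ary trees and with [e = 1] for d-ary ones; the congruence
   yields the spine length [m]. *)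
have max_ge (P : pred tree) e n : (forall m, P (comb e m)) ->
    (k <= n)%N -> n = 1 %[mod e] -> 1 - K e / n%:R <= max_tree P n (density n).
  move=> Pcomb k_le_n n_mod.
  have n_gt0 : (0 < n)%N by exact: leq_trans k_le_n.
  have /dvdnP[m n1E] : (e %| n - 1)%N by rewrite -eqn_mod_dvd //; apply/eqP.
  have nE : nleaves (comb e m) = n by rewrite nleaves_comb -n1E subnK.
  rewrite -nE; apply: le_trans (density_comb_ge _ _ _) _; rewrite ?nE //.
  apply: (@max_tree_ge _ _ _ _ _ 'C(n, k)) => // T' _ nT'.
  by rewrite -{2}(nleaves_caterpillar2 k_gt0) -nT' c_le_bin.
have strict_ge n : (k <= n)%N -> n = 1 %[mod d.-1] ->
    1 - K d.-1 / n%:R <= max_tree (strictly_dary d) n (density n).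
  by apply: max_ge => m; apply: all_inner_comb; rewrite (ltn_predK hd).
have max_le1 P n : max_tree P n (density n) <= 1.
  by apply: max_tree_le => // T _; apply: density_le.
have max_gammaE P n : max_tree P n (gamma R (caterpillar2 k)) = max_tree P n (density n).
  by apply: eq_max_tree => T; apply: densityE.
split; last split.
- exists (K d.-1) => n k_le_n n_mod.
  by rewrite distrC ger0_norm ?subr_ge0 // lerBlDr -lerBlDl strict_ge.
- apply: (@limf_esup_eq1 _ _ _ (K d.-1)).
  + exact: filterT.
  + by move=> n; rewrite max_gammaE.
  + move=> A [N0 _ AN0] N.
    (* Since [d.-1] is positive, this is a number in the residue class of 1 beyond all three
       bounds. *)
    pose n := ((maxn N (maxn N0 k)) * d.-1 + 1)%N.
    have n_ge : (maxn N (maxn N0 k) <= n)%N.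
      by rewrite /n (leq_trans _ (leq_addr _ _)) // leq_pmulr // -ltnS (ltn_predK hd).
    move: n_ge; rewrite !geq_max => /and3P[N_le N0_le k_le].
    have n_mod : n = 1 %[mod d.-1] by rewrite /n modnMDl.
    by exists n; rewrite max_gammaE; split; [apply: AN0| |apply: strict_ge].
- apply: (@limf_esup_eq1 _ _ _ (K 1)).
  + exact: filterT.
  + by move=> n; rewrite max_gammaE.
  + move=> A [N0 _ AN0] N.
    have := leqnn (maxn N (maxn N0 k)); rewrite {1}geq_max => /andP[].
    set n := maxn N _; rewrite geq_max => N_le /andP[N0_le k_le].
    exists n; rewrite max_gammaE; split; [exact: AN0|by []|].
    (* Modulo 1 every [n] qualifies, and the binary comb is d-ary because [2 <= d]. *)
    apply: max_ge; rewrite ?modn1 // => m.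
    exact: all_inner_comb.
Qed.
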